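(* Let $(M,\omega)$ be a closed Kähler manifold of complex dimension $n\geq 1$. There is an isometric immersion $A$ of $\mathcal C$, with the Calabi metric, into $C^\infty(M,\mathbb R)$ with the Euclidean metric, and the image $A(\mathcal C)$ is a portion of an infinite-dimensional sphere, i.e. there is $r>0$ such that $A(\mathcal C)\subset\{f\in C^\infty(M,\mathbb R):\int_Mf^2\frac{\omega^n}{n!}=r^2\}$. Moreover, for every $u_0\in\mathcal C$ the distance of $u_0$ from the boundary $\partial\mathcal C$ is zero, i.e. $\inf_{w\in\partial\mathcal C}d(u_0,w)=0$.
   Context: Let $(M,\omega)$ be a closed Kähler manifold of complex dimension $n$, $\mathrm{Vol}=\int_M\frac{\omega^n}{n!}$, and $\mathcal C=\{u\in C^\infty(M,\mathbb R): \int_M e^u\frac{\omega^n}{n!}=\int_M\frac{\omega^n}{n!}\}$, with tangent spaces $T_u\mathcal C=\{v\in C^\infty(M,\mathbb R):\int_M v e^u\frac{\omega^n}{n!}=0\}$ and the Calabi metric $\langle v,w\rangle_u=\int_M vw\,e^u\frac{\omega^n}{n!}$. A smooth curve in $\mathcal C$ (or in $C^\infty(M,\mathbb R)$) is a map $u$ from an interval such that $(t,p)\mapsto u(t)(p)$ is smooth. The Euclidean metric on $C^\infty(M,\mathbb R)$ is $\prec\psi,\chi\succ=\int_M\psi\chi\frac{\omega^n}{n!}$ at every point. An isometric immersion $A:\mathcal C\to C^\infty(M,\mathbb R)$ is a map sending smooth curves to smooth curves, with a well-defined linear differential $(dA)_u(v)=\frac{d}{dt}|_{t=0}A(\gamma(t))$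 for any smooth curve $\gamma$ in $\mathcal C$ with $\gamma(0)=u$, $\gamma'(0)=v$, satisfying $\prec(dA)_u(v),(dA)_u(w)\succ=\langle v,w\rangle_u$ for all $u\in\mathcal C$, $v,w\in T_u\mathcal C$. The boundary is $\partial\mathcal C=\{u:M\to\mathbb R\cup\{-\infty\}\text{ smooth}: \int_Me^u\frac{\omega^n}{n!}=\int_M\frac{\omega^n}{n!},\ \exists x\in M,\ u(x)=-\infty\}$, where smoothness of such $u$ means that $e^{u/2}$ is a smooth function on $M$ (with $e^{-\infty}=0$). The geodesic distance of the Calabi metric is $d(u_0,u_1)=2\sqrt{\mathrm{Vol}}\,\arccos\big(\frac1{\mathrm{Vol}}\int_Me^{\frac{u_0+u_1}2}\frac{\omega^n}{n!}\big)$, and this formula is also used when $u_1\in\partial\mathcal C$. *)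

(* Defs.v *)
From HB Require Import structures.
From mathcomp Require Import all_boot all_order all_algebra.
From mathcomp Require Import perm.
From mathcomp Require Import all_classical all_reals all_analysis.

Set Implicit Arguments.
Unset Strict Implicit.
Unset Printing Implicit Defensive.

Import Order.TTheory GRing.Theory Num.Theory.
Import numFieldNormedType.Exports.

Local Open Scope classical_set_scope.
Local Open Scope ring_scope.

Section Smoothness.
Context {R : realType} {V W : normedModType R}.

(* Iterated directional derivatives; meaningful for open O only, see smooth_on
   below for arbitrary sets. *)
Fixpoint Ck (k : nat) (O : set V) (f : V -> W) : Prop :=
  if k is k'.+1 then
    (forall x, O x -> differentiable f x) /\
    (forall v, Ck k' O (fun x => 'D_v f x))
  else forall x, O x -> {for x, continuous f}.

Definition smooth_open (O : set V) (f : V -> W) : Prop :=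
  forall k, Ck k O f.

(* f has, near each point of S, a smooth extension to an open set. *)
Definition smooth_on (S : set V) (f : V -> W) : Prop :=
  forall x, S x -> exists (O : set V) (g : V -> W),
    [/\ open O, O x, smooth_open O g & forall y, S y -> O y -> f y = g y].

End Smoothness.

Section LebesgueTuple.
Context {R : realType}.

Definition tcons (m : nat) (p : m.-tuple R * R) : m.+1.-tuple R :=
  [tuple of p.2 :: p.1].

Lemma measurable_tcons m : measurable_fun setT (@tcons m).
Proof.
exact: (measurable_cons measurable_snd measurable_fst).
Qed.

Lemma measurable_preimage_tcons m (A : set (m.+1.-tuple R)) :
  measurable A -> measurable (@tcons m @^-1` A).
Proof.
by move=> mA; rewrite -[X in measurable X]setTI; exact: measurable_tcons.
Qed.

Section Step.
Context {m : nat} (nu : {measure set (m.-tuple R) -> \bar R}).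

Definition leb_step : set (m.+1.-tuple R) -> \bar R :=
  pushforward (nu \x lebesgue_measure)%E (@tcons m).

Let leb_step0 : leb_step set0 = 0%E.
Proof. by rewrite /leb_step /pushforward preimage_set0 measure0. Qed.

Let leb_step_ge0 A : (0 <= leb_step A)%E.
Proof. by rewrite /leb_step /pushforward measure_ge0. Qed.

Let leb_step_sigma_additive : semi_sigma_additive leb_step.
Proof.
move=> F mF tF mUF; rewrite /leb_step /pushforward preimage_bigcup.
apply: measure_semi_sigma_additive.
- by move=> n; exact: measurable_preimage_tcons.
- apply/trivIsetP => /= i j _ _ ij; rewrite -preimage_setI.
  by move/trivIsetP : tF => /(_ _ _ _ _ ij) ->//; rewrite preimage_set0.
- by rewrite -preimage_bigcup; exact: measurable_preimage_tcons.
Qed.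

HB.instance Definition _ := isMeasure.Build _ _ _ leb_step
  leb_step0 leb_step_ge0 leb_step_sigma_additive.

End Step.

(* Lebesgue measure of R^m, on the product sigma-algebra of m.-tuple R. *)
Fixpoint leb (m : nat) : {measure set (m.-tuple R) -> \bar R} :=
  if m is m'.+1 then leb_step (leb m') else dirac [tuple].

End LebesgueTuple.

(* C^n as R^(2n): the first n coordinates are the real parts x_k, the last n
   the imaginary parts y_k. *)
Notation Cn R n := 'rV[R]_(n + n).

Section ComplexSpace.
Context {R : realType} {n : nat}.
Local Notation V := (Cn R n).

Definition row_of (t : (n + n).-tuple R) : V := \row_i tnth t i.

Definition mulJ (v : V) : V :=
  row_mx (- rsubmx v) (lsubmx v).

(* The frame d/dx_1, d/dy_1, ..., d/dx_n, d/dy_n : (k, false) is d/dx_k and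
   (k, true) is d/dy_k. *)
Definition frame (a : 'I_n * bool) : V :=
  delta_mx 0 (if a.2 then rshift n a.1 else lshift n a.1).

(* Value of the n-th exterior power of the 2-form w on that frame, for the
   wedge product with (dx /\ dy)(d/dx, d/dy) = 1. *)
Definition wedge_power (w : V -> V -> R) : R :=
  (2 ^+ n)^-1 * \sum_(s : {perm 'I_n * bool})
    (-1) ^+ s * \prod_(k < n) w (frame (s (k, false))) (frame (s (k, true))).

End ComplexSpace.

Section Kahler.
Context {R : realType} {n : nat}.
Local Notation V := (Cn R n).

(* chart_inv i is the inverse of chart i : dom i -> V; its values outside the
   image of dom i are irrelevant, as are those of chart i outside dom i. *)
Record complex_atlas (M : ptopologicalType) := ComplexAtlas {
  chart_index : Type;
  dom : chart_index -> set M;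
  chart : chart_index -> M -> V;
  chart_inv : chart_index -> V -> M;
  dom_open : forall i, open (dom i);
  dom_cover : forall p, exists i, dom i p;
  chart_image_open : forall i, open (chart i @` dom i);
  chartK : forall i p, dom i p -> chart_inv i (chart i p) = p;
  chart_continuous : forall i p, dom i p -> {for p, continuous (chart i)};
  inv_continuous : forall i x, (chart i @` dom i) x ->
    {for x, continuous (chart_inv i)};
  transition_smooth : forall i j,
    smooth_open (chart i @` (dom i `&` dom j)) (chart j \o chart_inv i);
  transition_holomorphic : forall i j x v,
    (chart i @` (dom i `&` dom j)) x ->
    'D_(mulJ v) (chart j \o chart_inv i) x = mulJ ('D_v (chart j \o chart_inv i) x)
}.

(* form i x is the Kaehler form, read in the chart i at the point of
   coordinates x. *)
Record kahler_form (M : ptopologicalType) (X : complex_atlas M) := KahlerForm {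
  form : chart_index X -> V -> V -> V -> R;
  form_smooth : forall (i : chart_index X) v w,
    smooth_open (chart i @` dom i) (fun x => form i x v w);
  form_linear : forall i x u v w a, (chart i @` dom i) x ->
    form i x (a *: u + v) w = a * form i x u w + form i x v w;
  form_alternating : forall i x v w, (chart i @` dom i) x ->
    form i x v w = - form i x w v;
  form_change : forall i j x v w, (chart i @` (dom i `&` dom j)) x ->
    form i x v w = form j ((chart j \o chart_inv i) x)
      ('D_v (chart j \o chart_inv i) x) ('D_w (chart j \o chart_inv i) x);
  (* d omega = 0, on constant vector fields *)
  form_closed : forall i x u v w, (chart i @` dom i) x ->
    'D_u (fun y => form i y v w) x + 'D_v (fun y => form i y w u) x
      + 'D_w (fun y => form i y u v) x = 0;
  form_J_invariant : forall i x v w, (chart i @` dom i) x ->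
    form i x (mulJ v) (mulJ w) = form i x v w;
  form_positive : forall i x v, (chart i @` dom i) x ->
    v != 0 -> 0 < form i x v (mulJ v)
}.

Record closed_kahler_manifold (M : ptopologicalType) := ClosedKahlerManifold {
  atlas : complex_atlas M;
  kform : kahler_form atlas;
  hausdorff_carrier : hausdorff_space M;
  compact_carrier : compact [set: M]
}.

Definition borel (M : ptopologicalType) := g_sigma_algebraType (@open M).

(* Coefficient of omega^n / n! in the coordinates of the chart i. *)
Definition volume_density (M : ptopologicalType)
    (K : closed_kahler_manifold M) (i : chart_index (atlas K)) (x : V) : R :=
  (n`!%:R)^-1 * wedge_power (form (kform K) i x).

(* mu is the measure defined by the positive top-degree form omega^n / n!;
   as the charts cover M, this determines mu. *)
Definition is_volume_measure (M : ptopologicalType)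
    (K : closed_kahler_manifold M)
    (mu : {measure set (borel M) -> \bar R}) : Prop :=
  forall (i : chart_index (atlas K)) (B : set (borel M)), measurable B -> B `<=` dom i ->
    mu B = (\int[leb (n + n)]_(t in row_of @^-1` (chart i @` B))
              (volume_density i (row_of t))%:E)%E.

Section Calabi.
Context {M : ptopologicalType}.
Variables (K : closed_kahler_manifold M)
  (mu : {measure set (borel M) -> \bar R}).

Definition smooth (f : M -> R) : Prop :=
  forall i : chart_index (atlas K), smooth_open (chart i @` dom i)
    (f \o chart_inv i).

Definition smooth_curve (I : set R) (u : R -> M -> R) : Prop :=
  forall i : chart_index (atlas K), smooth_on (I `*` (chart i @` dom i))
    (fun z : R * V => u z.1 (chart_inv i z.2)).

Definition integral_M (f : borel M -> R) : R := (\int[mu]_p f p)%R.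

Definition Vol : R := integral_M (fun=> 1).

Definition calC : set (M -> R) :=
  [set u | smooth u /\ integral_M (fun p => expR (u p)) = Vol].

Definition TcalC (u : M -> R) : set (M -> R) :=
  [set v | smooth v /\ integral_M (fun p => v p * expR (u p)) = 0].

Definition calabi (u v w : M -> R) : R :=
  integral_M (fun p => v p * w p * expR (u p)).

Definition euclid (v w : M -> R) : R := integral_M (fun p => v p * w p).

Definition curve_in_calC (I : set R) (u : R -> M -> R) : Prop :=
  smooth_curve I u /\ (forall t, I t -> calC (u t)).

(* v is the velocity at time 0 of the curve u, defined on I
   (one-sided if 0 is an end point of I). *)
Definition velocity0 (I : set R) (u : R -> M -> R) (v : M -> R) : Prop :=
  forall p, t^-1 * (u t p - u 0 p) @[t --> within I 0^'] --> v p.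

Definition is_differential (A : (M -> R) -> M -> R) (u : M -> R)
    (L : (M -> R) -> M -> R) : Prop :=
  [/\ forall v, TcalC u v -> smooth (L v),
      forall a v w, TcalC u v -> TcalC u w ->
        L (fun p => a * v p + w p) = (fun p => a * L v p + L w p) &
      forall I g v, is_interval I -> I 0 -> curve_in_calC I g -> g 0 = u ->
        TcalC u v -> velocity0 I g v ->
        velocity0 I (fun t => A (g t)) (L v)].

Definition isometric_immersion (A : (M -> R) -> M -> R) : Prop :=
  [/\ forall u, calC u -> smooth (A u),
      forall I g, is_interval I -> curve_in_calC I g ->
        smooth_curve I (fun t => A (g t)) &
      forall u, calC u -> exists L, is_differential A u L /\
        (forall v w, TcalC u v -> TcalC u w ->
           euclid (L v) (L w) = calabi u v w)].

(* exp (u / 2), with exp (-oo) = 0 *)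
Definition exp_half (u : M -> \bar R) (p : M) : R :=
  fine (expeR (u p * (2^-1)%:E)%E).

Definition boundary_calC : set (M -> \bar R) :=
  [set w | [/\ forall p, w p != +oo%E, smooth (exp_half w),
     integral_M (fun p => fine (expeR (w p))) = Vol &
     exists p, w p = -oo%E]].

Definition calabi_dist (u0 u1 : M -> \bar R) : R :=
  2 * Num.sqrt Vol *
  acos (Vol^-1 * integral_M (exp_half (fun p => (u0 p + u1 p)%E))).

End Calabi.
End Kahler.
Arguments complex_atlas : clear implicits.
Arguments closed_kahler_manifold : clear implicits.

(* Main.v *)
Require Import Defs.
From mathcomp Require Import finmap.
From mathcomp Require Import all_boot all_order all_algebra.
From mathcomp Require Import perm.
From mathcomp Require Import all_classical all_reals all_analysis.
From mathcomp Require Import measurable_realfun.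
From mathcomp Require Import ring lra.

(* The map A(u) = 2 exp(u/2) has differential v |-> exp(u/2) v, which turns the
   Euclidean metric into the Calabi metric, and the integral of A(u)^2 is 4 Vol.

   For the boundary, let b be a smooth bump with values in [0, 1] equal to 1 at
   a single point x0. Then h_k = 1 - b^k vanishes at x0 and tends to 1 away from
   x0, so that exp(u0/2) h_k, normalised in L^2, is exp(w_k/2) for some w_k in
   the boundary whose angle to u0 tends to 0 by dominated convergence, {x0}
   being negligible because n >= 1.

   The volume is positive because omega^n does not vanish: the alternating sum
   that defines it vanishes on every family of vectors as soon as it does on the
   coordinate frame, but it is positive on e_1, J e_1, ..., e_n, J e_n when the
   e_k are orthogonal for the Hermitian form. *)

Set Implicit Arguments.
Unset Strict Implicit.
Unset Printing Implicit Defensive.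
Import Order.TTheory GRing.Theory Num.Theory.
Import numFieldNormedType.Exports.
Local Open Scope classical_set_scope.
Local Open Scope ring_scope.

(** * Nonvanishing of the volume form *)

Section WedgePower.
Context {R : realType} {n : nat}.
Local Notation V := (Cn R n).
Local Notation T := ('I_n * bool)%type.
Variable w : V -> V -> R.
Hypothesis w_linear : forall a u v x, w (a *: u + v) x = a * w u x + w v x.
Hypothesis w_alt : forall u v, w u v = - w v u.
Hypothesis w_J : forall u v, w (mulJ u) (mulJ v) = w u v.
Hypothesis w_pos : forall v, v != 0 -> 0 < w v (mulJ v).

(** The summand of [wedge_power] with arbitrary vectors in place of the coordinate frame, so that
    the sum over [s] becomes an alternating multilinear form in 2n vectors. *)
Definition pairing_term (f : T -> V) (s : {perm T}) : R :=
  (-1) ^+ s * \prod_(k < n) w (f (s (k, false))) (f (s (k, true))).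

Definition alternating_sum (f : T -> V) : R := \sum_(s : {perm T}) pairing_term f s.

Lemma alternating_sum_perm f (t : {perm T}) :
  alternating_sum (f \o t) = (-1) ^+ t * alternating_sum f.
Proof.
rewrite /alternating_sum (reindex_inj (mulIg t^-1%g)) big_distrr /=.
apply: eq_bigr => s _; rewrite /pairing_term odd_permM odd_permV signr_addb.
rewrite [_ * (-1) ^+ t]mulrC -mulrA; congr (_ * (_ * _)).
by apply: eq_bigr => k _ /=; rewrite !permM !permKV.
Qed.

(** The transposition of [a] and [b] fixes [f] but reverses the sign of the sum. *)
Lemma alternating_sum_eq0 f a b : a != b -> f a = f b -> alternating_sum f = 0.
Proof.
move=> ab fab; have : alternating_sum f = - alternating_sum f.
  rewrite -{1}(_ : f \o tperm a b = f).
    by rewrite alternating_sum_perm odd_tperm ab expr1 mulN1r.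
  by apply/funext => x /=; case: tpermP => // ->.
by move/eqP; rewrite -addr_eq0 -mulr2n mulrn_eq0 /= => /eqP.
Qed.

Definition update (f : T -> V) (a : T) (x : V) : T -> V :=
  fun b => if b == a then x else f b.

Lemma w_linearr a u v x : w x (a *: u + v) = a * w x u + w x v.
Proof. by rewrite w_alt w_linear (w_alt u) (w_alt v); ring. Qed.

(** The vector at [a] enters each term through a single factor, the one with [a = s (k, e)], and [w]
    is linear in both arguments. *)
Lemma alternating_sum_linear f a c x y :
  alternating_sum (update f a (c *: x + y)) =
  c * alternating_sum (update f a x) + alternating_sum (update f a y).
Proof.
rewrite /alternating_sum big_distrr -big_split /=; apply: eq_bigr => s _.
rewrite /pairing_term.
have [[k e] ->] : exists b, a = s b by exists (s^-1%g a); rewrite permKV.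
rewrite !(bigD1 (P := xpredT) k) //=.
have E z : \prod_(i < n | i != k) w (update f (s (k, e)) z (s (i, false)))
       (update f (s (k, e)) z (s (i, true))) =
   \prod_(i < n | i != k) w (f (s (i, false))) (f (s (i, true))).
  apply: eq_bigr => i ik; rewrite /update !(inj_eq perm_inj) !xpair_eqE.
  by rewrite (negbTE ik).
rewrite !E; case: e {E}; rewrite /update !(inj_eq perm_inj) !xpair_eqE !eqxx /=.
  rewrite w_linearr; move: (w _ x) (w _ y) (\prod_(_ < _ | _) _) => wx wy p.
  by move: ((-1) ^+ s) => sg; ring.
rewrite w_linear; move: (w x _) (w y _) (\prod_(_ < _ | _) _) => wx wy p.
by move: ((-1) ^+ s) => sg; ring.
Qed.

Lemma alternating_sum_update0 f a : alternating_sum (update f a 0) = 0.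
Proof.
have := alternating_sum_linear f a 1 0 0.
by rewrite scaler0 addr0 mul1r => /eqP; rewrite addrC -subr_eq subrr eq_sym => /eqP.
Qed.

Lemma frame_sum (v : V) : exists c : T -> R, v = \sum_(b : T) c b *: frame b.
Proof.
exists (fun b => v 0 (if b.2 then rshift n b.1 else lshift n b.1)).
rewrite {1}(row_sum_delta v) big_split_ord /=.
pose F i d := v 0 (if d then rshift n i else lshift n i) *: frame (i, d).
rewrite [RHS](eq_bigr (fun b : T => F b.1 b.2)); last by case.
rewrite -(pair_bigA _ F) /=.
rewrite -big_split /=; apply: eq_bigr => i _.
by rewrite big_bool /= addrC.
Qed.

(** Induction on the number of vectors outside the frame: expanding one of them in the frame puts
    frame vectors in its place and lowers the count. *)
Lemma alternating_sum_frame f :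
  alternating_sum frame = 0 -> alternating_sum f = 0.
Proof.
move=> W0.
suff H : forall N (g : T -> V),
    (#|[pred a : T | ~~ [exists b, g a == frame b]]| <= N)%N ->
    alternating_sum g = 0 by exact: (H _ f (leqnn _)).
elim=> [|N IH] g.
  rewrite leqn0 => /eqP/card0_eq g0.
  have /choice[p pE] : forall a, exists b, g a = frame b.
    move=> a; have := g0 a; rewrite !inE => /negbFE/existsP[b /eqP ->].
    by exists b.
  (* All vectors now lie in the frame: either they are a permutation of it, or one of them is
     repeated. *)
  have [pi|] := boolP (injectiveb p).
    have -> : g = frame \o (perm (injectiveP _ pi)).
      by apply/funext => a /=; rewrite pE permE.
    by rewrite alternating_sum_perm W0 mulr0.
  move=> /injectivePn[a [b ab pab]].
  by apply: (alternating_sum_eq0 ab); rewrite !pE pab.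
move=> gN.
have [/existsP[a ga]|] := boolP [exists a, ~~ [exists b, g a == frame b]]; last first.
  move=> /existsPn g0; apply: IH; rewrite eq_card0// => a.
  by rewrite !inE (negbTE (g0 a)).
have -> : g = update g a (g a).
  by apply/funext => b; rewrite /update; case: eqP => // ->.
have [c ->] := frame_sum (g a).
elim/big_rec : _ => [|b v _ IHv]; first exact: alternating_sum_update0.
rewrite alternating_sum_linear IHv addr0 IH ?mulr0//.
rewrite -ltnS; apply: leq_trans gN; apply: proper_card; apply/properP; split.
  apply/fintype.subsetP => x; rewrite !inE /update; case: eqP => // _ /negP[].
  by apply/existsP; exists b.
exists a; rewrite !inE // negbK /update eqxx.
by apply/existsP; exists b.
Qed.

(** [s] is the product of [p] acting on the [false] copy and of its conjugate by the flip of the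
    booleans, which acts on the [true] copy; both have the same parity. *)
Lemma odd_perm_pair (p : {perm 'I_n}) (s : {perm T}) :
  (forall k e, s (k, e) = (p k, e)) -> odd_perm s = false.
Proof.
move=> sE.
pose h (x : T) := if x.2 then x else (p x.1, x.2).
have hi : injective h.
  by move=> [x []] [y []] //= []// /perm_inj ->.
have ti : injective (fun x : T => (x.1, ~~ x.2)).
  by move=> [x e] [y d] /= [-> /(inv_inj negbK) ->].
have -> : s = (perm hi * (perm ti * perm hi * perm ti))%g.
  by apply/permP => -[k e]; rewrite sE !permM !permE /=; case: e.
by rewrite !odd_permM; do 2!case: (odd_perm _).
Qed.

(** The sign of the permutation and the [k]-th factor both change sign. *)
Lemma pairing_term_swap f (s : {perm T}) k :
  pairing_term f (tperm (k, false) (k, true) * s)%g = pairing_term f s.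
Proof.
rewrite /pairing_term odd_permM odd_tperm xpair_eqE andbF /= signrN.
rewrite !(bigD1 (P := xpredT) k) //= !permM tpermL tpermR.
rewrite (w_alt (f (s (k, true)))); under eq_bigr => i ik.
  rewrite !permM !tpermD ?xpair_eqE 1?eq_sym ?(negbTE ik) //; over.
by rewrite (mulNr (w _ _)) mulrNN.
Qed.

Lemma mulJK (v : V) : mulJ (mulJ v) = - v.
Proof.
by rewrite /mulJ row_mxKr row_mxKl -opp_row_mx hsubmxK.
Qed.

Lemma w_JN u v : w (mulJ u) v = - w u (mulJ v).
Proof.
rewrite -w_J mulJK -[- u](addr0 _) -scaleN1r w_linear.
have -> : w 0 (mulJ v) = 0.
  by have := w_linear 1 0 0 (mulJ v); rewrite scaler0 addr0 mul1r; lra.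
ring.
Qed.

(** Gram-Schmidt by a count of dimensions: orthogonality to [k] earlier vectors and to their images
    under [mulJ] amounts to 2k linear equations in 2n unknowns, which have a nonzero solution as
    long as k < n. *)
Lemma orthogonal_family k : (k <= n)%N -> exists e : nat -> V,
  (forall i, (i < k)%N -> e i != 0) /\
  (forall i j, (i < j < k)%N -> w (e j) (e i) = 0 /\ w (e j) (mulJ (e i)) = 0).
Proof.
elim: k => [_|k IH kn]; first by exists (fun=> 0); split => // i j; rewrite ltn0 andbF.
have [e [e0 eo]] := IH (ltnW kn).
(* The columns of [N] are the functionals [w _ (e j)] and [w _ (mulJ (e j))], so the next vector is
   sought in the left kernel of [N]. *)
pose N : 'M[R]_(n + n, k + k) :=
  row_mx (\matrix_(a, j) w (delta_mx 0 a) (e j))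
         (\matrix_(a, j) w (delta_mx 0 a) (mulJ (e j))).
have w_sum (v x : V) : w v x = \sum_a v 0 a * w (delta_mx 0 a) x.
  rewrite {1}(row_sum_delta v); elim/big_rec2 : _ => [|a y z _ <-].
    by have := w_linear 1 0 0 x; rewrite scaler0 addr0 mul1r; lra.
  by rewrite w_linear.
have : kermx N != 0.
  rewrite kermx_eq0 /row_free neq_ltn; apply/orP; left.
  by rewrite (leq_ltn_trans (rank_leq_col _))// -addnS leq_add // ltnW.
move=> /rowV0Pn[v /sub_kermxP vN v0].
have [vl vr] : v *m lsubmx N = 0 /\ v *m rsubmx N = 0.
  rewrite -(hsubmxK N) mul_mx_row in vN.
  by split; [have /(congr1 lsubmx) := vN | have /(congr1 rsubmx) := vN];
    rewrite ?row_mxKl ?row_mxKr ?linear0.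
exists (fun i => if i == k then v else e i); split => [i|i j /andP[ij]].
  rewrite ltnS leq_eqVlt; case: eqP => //= _; exact: e0.
rewrite ltnS leq_eqVlt => /predU1P[jk|jk]; last first.
  by rewrite (ltn_eqF jk) (ltn_eqF (ltn_trans ij jk)); apply: eo; rewrite ij.
rewrite jk eqxx in ij *; rewrite (ltn_eqF ij) !(w_sum v); split.
  have /matrixP/(_ 0 (Ordinal ij)) := vl; rewrite !mxE => e0i; rewrite -[RHS]e0i.
  by apply: eq_bigr => a _; rewrite row_mxKl mxE.
have /matrixP/(_ 0 (Ordinal ij)) := vr; rewrite !mxE => e0i; rewrite -[RHS]e0i.
by apply: eq_bigr => a _; rewrite row_mxKr mxE.
Qed.

Section OrthogonalFamily.
Variable f : T -> V.
Hypothesis f_orth : forall i j d e, i != j -> w (f (i, d)) (f (j, e)) = 0.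
Hypothesis f_pos : forall i, 0 < w (f (i, false)) (f (i, true)).

(** If [s] sends some pair to two different indices, a factor vanishes. Otherwise [s] permutes the
    pairs, and undoing the reversed ones by [pairing_term_swap] leads to an even permutation with
    positive factors. *)
Lemma pairing_term_orth_ge0 (s : {perm T}) : 0 <= pairing_term f s.
Proof.
have [/existsP[k sk]|/existsPn s_pair] :=
    boolP [exists k, (s (k, false)).1 != (s (k, true)).1].
  rewrite /pairing_term (bigD1 (P := xpredT) k) //=.
  rewrite (surjective_pairing (s (k, false))) (surjective_pairing (s (k, true))).
  by rewrite f_orth// mul0r mulr0.
(* Induction on the number of pairs whose order [s] reverses. *)
move: {2}#|_| (leqnn #|[pred k | (s (k, false)).2]|) s_pair => N.
elim: N s => [|N IH] s sN s_pair.
  move: sN; rewrite leqn0 => /eqP/card0_eq s0.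
  have sF k : s (k, false) = ((s (k, false)).1, false).
    by move: (s0 k); rewrite !inE; case: (s _) => a [].
  have sT k : s (k, true) = ((s (k, false)).1, true).
    have := s_pair k; rewrite negbK sF /= => /eqP ->.
    case E : (s (k, true)) => [a []] //=; have := s_pair k; rewrite negbK E /= => /eqP E'.
    by have := sF k; rewrite E' -E => /perm_inj.
  have pi : injective (fun k => (s (k, false)).1).
    by move=> a b ab; have := sF a; rewrite ab -sF => /perm_inj[].
  rewrite /pairing_term (@odd_perm_pair (perm pi)); last first.
    by move=> k []; rewrite permE ?sT -?sF.
  rewrite mul1r prodr_ge0// => k _; rewrite sT {1}sF; exact: ltW.
have [s0|/card_gt0P[k]] := posnP #|[pred k | (s (k, false)).2]|;
  last rewrite inE => sk.
  by apply: IH => //; rewrite s0.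
have skT : (s (k, true)).2 = false.
  apply/negP => skT; have := s_pair k; rewrite negbK => /eqP E.
  have : s (k, false) = s (k, true).
    by rewrite (surjective_pairing (s (k, true))) -E skT -sk -surjective_pairing.
  by move/perm_inj.
rewrite -(pairing_term_swap f s k); apply: IH.
  rewrite -ltnS; apply: leq_trans sN; apply: proper_card; apply/properP; split.
    apply/fintype.subsetP => i; rewrite !inE permM.
    have [->|ik] := eqVneq i k; first by rewrite tpermL skT.
    by rewrite tpermD ?xpair_eqE 1?eq_sym ?(negbTE ik).
  by exists k; rewrite !inE ?permM ?tpermL ?skT.
move=> i; rewrite !permM; have [->|ik] := eqVneq i k.
  by rewrite tpermL tpermR eq_sym s_pair.
have ki : (k == i) = false by rewrite eq_sym (negbTE ik).
by rewrite !tpermD ?xpair_eqE ?ki ?andbF.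
Qed.

Lemma alternating_sum_orth_gt0 : 0 < alternating_sum f.
Proof.
rewrite /alternating_sum (bigD1 (1%g : {perm T})) //= ltr_pwDl ?sumr_ge0//; last first.
  by move=> s _; exact: pairing_term_orth_ge0.
by rewrite /pairing_term odd_perm1 mul1r prodr_gt0// => k _; rewrite !perm1.
Qed.

End OrthogonalFamily.

Lemma wedge_power_neq0 : wedge_power w != 0.
Proof.
rewrite /wedge_power mulf_neq0 ?invr_eq0 ?expf_neq0 ?pnatr_eq0//.
apply/eqP => /alternating_sum_frame W0.
have [e [e0 eo]] := orthogonal_family (leqnn n).
have wxx x : w x x = 0 by have := w_alt x x; lra.
have ee i j : (i < n)%N -> (j < n)%N -> i != j -> w (e i) (e j) = 0.
  move=> iN jN; rewrite neq_ltn => /orP[ij|ji].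
    by rewrite w_alt (eo i j _).1 ?ij// oppr0.
  by rewrite (eo j i _).1 ?ji.
have eJ i j : (i < n)%N -> (j < n)%N -> i != j -> w (e i) (mulJ (e j)) = 0.
  move=> iN jN; rewrite neq_ltn => /orP[ij|ji].
    by rewrite w_alt w_JN opprK (eo i j _).2 ?ij.
  by rewrite (eo j i _).2 ?ji.
pose f (a : T) := if a.2 then mulJ (e a.1) else e a.1.
suff : 0 < alternating_sum f by rewrite W0 ltxx.
apply: alternating_sum_orth_gt0 => [i j d c ij|i].
  rewrite /f /=; case: d; case: c; rewrite ?w_J ?w_JN ?ee ?eJ ?oppr0//.
by rewrite /f /=; apply: w_pos; exact: e0.
Qed.

End WedgePower.

(** * Smooth functions *)

Lemma near_eq_differentiable (R : numFieldType) (V W : normedModType R)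
    (f g : V -> W) (x : V) :
  (\forall y \near x, f y = g y) -> differentiable f x -> differentiable g x.
Proof.
move=> fg df; have fgx := nbhs_singleton fg.
(* The first-order expansion of [f] is also one of [g], and uniqueness identifies the two
   differentials. *)
have dg : g \o shift x = cst (g x) + 'd f x +o_ 0 id.
  apply/eqaddoP => e e0.
  have /eqaddoP/(_ e e0) := diff_locally df.
  have fg0 : \forall h \near (0 : V), f (h + x) = g (h + x).
    by move: fg; rewrite (near_shift 0 x) /= subr0.
  apply: filterS2 fg0 => h fgh; congr (_ <= _); congr `| _ |.
  by rewrite /= !fctE /= fgh fgx.
have dgE : 'd g x = 'd f x :> (V -> W).
  by apply: diff_unique => //; exact: diff_continuous.
by apply/diff_locallyP; rewrite dgE; split => //; exact: diff_continuous.
Qed.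

Section CkTheory.
Context {R : realType} {V W : normedModType R}.
Implicit Types (O : set V) (f g : V -> W).

(** Openness of [O] makes the agreement hold near each point, so that it passes to the
    derivatives. *)
Lemma eq_Ck k O f g : open O -> (forall x, O x -> f x = g x) ->
  Ck k O f -> Ck k O g.
Proof.
elim: k f g => [|k IH] f g oO fg /=.
  move=> cf x Ox; have fgx : \forall y \near x, f y = g y.
    by apply: filterS fg _; exact: open_nbhs_nbhs.
  have := cf _ Ox; rewrite /prop_for /continuous_at (fg _ Ox); apply: cvg_trans.
  by apply: near_eq_cvg; apply: filterS fgx => y ->.
move=> [df Df]; split=> [x Ox|v].
  apply: near_eq_differentiable (df _ Ox).
  by apply: filterS fg _; exact: open_nbhs_nbhs.
apply: IH (Df v) => // x Ox; apply: near_eq_derive.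
by apply: filterS fg _; exact: open_nbhs_nbhs.
Qed.

(** Each condition in [Ck] is tested point by point on globally defined derivatives, so [U] may vary
    with the point. *)
Lemma Ck_local k O f :
  (forall x, O x -> exists U, U x /\ Ck k U f) -> Ck k O f.
Proof.
elim: k f => [|k IH] f loc /=.
  by move=> x /loc[U [Ux cf]]; exact: cf.
split=> [x /loc[U [Ux [fd _]]]|v]; first exact: fd.
by apply: IH => x /loc[U [Ux [_ /(_ v)]]]; exists U.
Qed.

Lemma Ck_continuous k O f x : Ck k O f -> O x -> {for x, continuous f}.
Proof.
case: k => [|k] /=; first by move=> cf; exact: cf.
by move=> [df _] Ox; exact/differentiable_continuous/df.
Qed.

Lemma Ck_pred k O f : Ck k.+1 O f -> Ck k O f.
Proof.
elim: k f => [|k IH] f; first by move=> Cf x; exact: Ck_continuous Cf.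
by move=> [df Df]; split => // v; exact: IH.
Qed.

Lemma Ck_cst k O (a : W) : Ck k O (cst a).
Proof.
elim: k a => [|k IH] a /=; first by move=> x _; exact: cvg_cst.
split=> [x _|v]; first exact: differentiable_cst.
by rewrite (_ : (fun _ => _) = cst 0)//; apply/funext => x; rewrite derive_cst.
Qed.

Lemma Ck_add k O f g : open O -> Ck k O f -> Ck k O g ->
  Ck k O (fun x => f x + g x).
Proof.
move=> oO; elim: k f g => [|k IH] f g /=.
  by move=> cf cg x Ox; apply: continuousD; [exact: cf|exact: cg].
move=> [df Df] [dg Dg]; split=> [x Ox|v].
  by apply: differentiableD; [exact: df|exact: dg].
apply: (eq_Ck (f := fun x => 'D_v f x + 'D_v g x)) => // [x Ox|]; last exact: IH.
by rewrite deriveD//; apply: diff_derivable; [exact: df|exact: dg].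
Qed.

End CkTheory.

Section CkScalar.
Context {R : realType} {V : normedModType R}.
Implicit Types (O : set V) (f g : V -> R).

Lemma Ck_mul k O f g : open O -> Ck k O f -> Ck k O g ->
  Ck k O (fun x => f x * g x).
Proof.
move=> oO; elim: k f g => [/= f g|k IH f g].
  by move=> cf cg x Ox; apply: continuousM; [exact: cf|exact: cg].
move=> Cf Cg; move: (Cf) (Cg) => -[df Df] [dg Dg]; split=> [x Ox|v].
  by apply: differentiableM; [exact: df|exact: dg].
apply: (eq_Ck (f := fun x => f x * 'D_v g x + g x * 'D_v f x)) => // [x Ox|].
  by rewrite deriveM//; apply: diff_derivable; [exact: df|exact: dg].
by apply: Ck_add => //; apply: IH; (exact: Ck_pred || exact: Df || exact: Dg).
Qed.

(* A class of functions closed under derivation consists of smooth functions;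
   this avoids naming the higher derivatives. *)
Lemma Ck_comp (P : set (R -> R)) k O f F :
  (forall G, P G -> exists2 G', P G' & forall y : R, is_derive y 1 G (G' y)) ->
  open O -> Ck k O f -> P F -> Ck k O (fun x => F (f x)).
Proof.
move=> Pd oO; elim: k f F => [/= f F|k IH f F].
  move=> cf /Pd[F' _ dF] x Ox.
  apply: (@continuous_comp _ _ _ f F); first exact: cf.
  by apply/differentiable_continuous/derivable1_diffP; case: (dF (f x)).
move=> Cf PF; have [F' PF' dF] := Pd _ PF; move: (Cf) => -[df Df].
have dF1 y : differentiable F y by apply/derivable1_diffP; case: (dF y).
split=> [x Ox|v]; first by apply: differentiable_comp => //; exact: df.
apply: (eq_Ck (f := fun x => F' (f x) * 'D_v f x)) => // [x Ox|]; last first.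
  by apply: Ck_mul => //; [exact: (IH _ _ (Ck_pred Cf) PF')|exact: Df].
have dfx := df x Ox.
rewrite (deriveE (f := F \o f) v (differentiable_comp dfx (dF1 _))).
rewrite diff_comp// (deriveE v dfx) /=.
have <- : 'd F (f x) 1 = F' (f x) by rewrite -deriveE//; case: (dF (f x)).
have -> : 'd f x v = 'd f x v *: (1 : R) by rewrite /GRing.scale /= mulr1.
by rewrite linearZ /= /GRing.scale /= mulr1 mulrC.
Qed.

Lemma Ck_coord k O m n (f : V -> 'M[R]_(m, n)) i j :
  open O -> Ck k O f -> Ck k O (fun x => f x i j).
Proof.
move=> oO; elim: k f => [/= f|k IH f].
  move=> cf x Ox.
  apply: (@continuous_comp _ _ _ f (fun M : 'M[R]_(m, n) => M i j)).
    exact: cf.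
  exact: coord_continuous.
move=> [df Df]; split=> [x Ox|v].
  apply: (@differentiable_comp _ _ _ _ f (fun M : 'M[R]_(m, n) => M i j)).
    exact: df.
  exact: differentiable_coord.
apply: (eq_Ck (f := fun x => ('D_v f x) i j)) => // [x Ox|]; last exact: IH (Df v).
by rewrite derive_mx ?mxE//; apply/diff_derivable/df.
Qed.

Lemma Ck_expR k O f a b : open O -> Ck k O f ->
  Ck k O (fun x => a * expR (b * f x)).
Proof.
move=> oO Cf.
(* The multiples of [expR (b * y)] form a class closed under derivation. *)
apply: (Ck_comp (P := [set F | exists c, F = fun y => c * expR (b * y)])
  (F := fun y => a * expR (b * y))) => //; last by exists a.
move=> _ [c ->]; exists (fun y => c * b * expR (b * y)); first by exists (c * b).
move=> y; apply: is_derive_eq.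
rewrite /GRing.scale /=; ring.
Qed.

End CkScalar.

(** * The flat function exp(-1/t) *)

Section FlatFunction.
Context {R : realType}.
Implicit Types (p : {poly R}) (t x : R).

(* With p = 1 this is the standard smooth function vanishing on t <= 0; the
   family over all p is closed under derivation. *)
Definition flat p t : R := if 0 < t then p.[t^-1] * expR (- t^-1) else 0.

(** A factor ['X] in the polynomial raises [m] by one, so induction on [p] reduces the bound to one
    for powers. Taken at x = 1/t, it controls [flat p] near 0. *)
Lemma horner_exp_bound p m :
  exists2 C, 0 <= C & forall x, 1 <= x -> `|p.[x]| * x ^+ m <= C * expR x.
Proof.
have expn_bound k x : 1 <= x -> x ^+ k <= k`!%:R * expR x.
  move=> x1; have x0 : 0 <= x by rewrite (le_trans _ x1).
  case: k => [|k]; first by rewrite expr0 mul1r (le_trans _ (expR_ge1Dx _))// lerDl.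
  have := expR_ge1Dxn k x0; rewrite -ler_pdivrMl ?ltr0n ?fact_gt0// mulrC => h.
  by apply: le_trans h; rewrite lerDr.
elim/poly_ind: p m => [|p c IH] m.
  by exists 0 => // x _; rewrite horner0 normr0 !mul0r.
have [C C0 CP] := IH m.+1; exists (C + `|c| * m`!%:R) => [|x x1].
  by rewrite addr_ge0// mulr_ge0.
have x0 : 0 <= x by rewrite (le_trans _ x1).
rewrite !hornerE mulrDl; apply: (@le_trans _ _ (`|p.[x]| * x ^+ m.+1 + `|c| * x ^+ m)).
  rewrite exprS mulrA -mulrDl ler_wpM2r ?exprn_ge0// (le_trans (ler_normD _ _))//.
  by rewrite normrM (ger0_norm x0).
by rewrite lerD ?CP// -mulrA ler_wpM2l// expn_bound.
Qed.

Lemma is_derive_flat p t :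
  is_derive t 1 (flat p) (flat ('X^2 * (p - p^`()))%R t).
Proof.
have [t0|t0|->] := ltgtP t 0.
- rewrite {2}/flat ltNge (ltW t0) /=.
  apply: (@near_eq_is_derive _ _ _ (cst 0)).
  near=> s; rewrite /flat ltNge ltW//=.
  by near: s; exact: lt_nbhsl.
- rewrite {2}/flat t0.
  apply: (@near_eq_is_derive R R^o R^o (fun s => p.[s^-1] * expR (- s^-1))).
    near=> s; rewrite /flat ifT//.
    by near: s; exact: lt_nbhsr.
  have tn0 : t != 0 by rewrite gt_eqF.
  have dV : is_derive t 1 (fun s : R => s^-1) (- t ^- 2).
    apply: is_derive_eq (is_deriveV (f := id) tn0 (is_derive_id t 1)) _.
    exact: mulr1.
  have dp : is_derive t 1 (fun s : R => p.[s^-1]) (p^`().[t^-1] * - t ^- 2).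
    exact: (@is_derive1_comp _ (horner p) (fun s => s^-1)).
  apply: is_derive_eq; rewrite /GRing.scale /= !hornerE /=.
  by field.
rewrite {2}/flat ltxx.
(* The exponent 2 leaves a factor h to spare: the difference quotient at 0 is at most C h. [C] is
   made positive because the tolerance is divided by it. *)
have [C C0 CP] : exists2 C, 0 < C &
    forall x, 1 <= x -> `|p.[x]| * x ^+ 2 <= C * expR x.
  have [C C0 CP] := horner_exp_bound p 2; exists (C + 1) => [|x x1].
    exact: ltr_wpDl.
  by rewrite (le_trans (CP _ x1))// ler_wpM2r ?expR_ge0// lerDl.
have q0 : h^-1 *: (flat p (h *: 1 + 0) - flat p 0) @[h --> 0^'] --> (0 : R).
  apply/cvgrPdist_le => e e0; near=> h.
  rewrite sub0r normrN {2}/flat ltxx subr0 addr0 /GRing.scale /= mulr1.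
  rewrite /flat; case: ifPn => h0; last by rewrite mulr0 normr0 ltW.
  have h1 : 1 <= h^-1.
    rewrite invf_ge1// -(gtr0_norm h0); near: h; exact: dnbhs0_le.
  have := CP _ h1; rewrite -[expR _]invrK -expRN => /(ler_wpM2r (expR_ge0 (- h^-1))).
  rewrite mulfVK ?expR_eq0// => hC.
  rewrite !normrM (ger0_norm (expR_ge0 _)) (gtr0_norm (x := h^-1)) ?invr_gt0//.
  apply: (@le_trans _ _ (C * h)).
    rewrite -(ler_pM2l (x := h^-1)) ?invr_gt0// [leRHS]mulrCA mulVf ?gt_eqF// mulr1.
    by apply: le_trans hC; rewrite exprS expr1 le_eqVlt; apply/orP; left; apply/eqP; ring.
  rewrite -ler_pdivlMl// mulrC -(gtr0_norm h0); near: h; apply: dnbhs0_le.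
  by rewrite divr_gt0.
split; first by apply/cvg_ex; exists 0.
by apply/cvg_lim.
Unshelve. all: by end_near.
Qed.

Lemma Ck_flat (V : normedModType R) k (O : set V) f p :
  open O -> Ck k O f -> Ck k O (fun z => flat p (f z)).
Proof.
move=> oO Cf; apply: (Ck_comp (P := range flat) (F := flat p)) => //.
by move=> _ [q _ <-]; exists (flat ('X^2 * (q - q^`()))%R) => // y; exact: is_derive_flat.
Qed.

Lemma Ck_sum (V : normedModType R) k (O : set V) I (r : seq I) (f : I -> V -> R) :
  open O -> (forall i, Ck k O (f i)) -> Ck k O (fun z => \sum_(i <- r) f i z).
Proof.
move=> oO Cf; elim: r => [|i r IH].
  by under eq_fun do rewrite big_nil; exact: Ck_cst.
by under eq_fun do rewrite big_cons; exact: Ck_add.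
Qed.

Lemma Ck_prod (V : normedModType R) k (O : set V) I (r : seq I) (f : I -> V -> R) :
  open O -> (forall i, Ck k O (f i)) -> Ck k O (fun z => \prod_(i <- r) f i z).
Proof.
move=> oO Cf; elim: r => [|i r IH].
  by under eq_fun do rewrite big_nil; exact: Ck_cst.
by under eq_fun do rewrite big_cons; exact: Ck_mul.
Qed.

End FlatFunction.

(** * The volume measure *)

Section IntegralBounds.
Context d (T : measurableType d) (R : realType) (mu : {measure set T -> \bar R}).
Implicit Types (D : set T) (f g : T -> \bar R).

(* No measurability is required, the integral of a nonnegative function being
   the supremum of the integrals of the simple functions below it. *)
Lemma ge0_le_integral_nonmeasurable D f g :
  (forall x, D x -> (0 <= f x)%E) -> (forall x, D x -> (f x <= g x)%E) ->
  (\int[mu]_(x in D) f x <= \int[mu]_(x in D) g x)%E.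
Proof.
move=> f0 fg; have g0 x : D x -> (0 <= g x)%E.
  by move=> Dx; rewrite (le_trans (f0 _ Dx))// fg.
rewrite !ge0_integralE//; apply: le_ereal_sup => _ [h hf <-]; exists h => // x.
apply: le_trans (hf x) _; rewrite !patchE; case: ifPn => //.
by rewrite inE => /fg.
Qed.

Lemma integral_le_cst D (f : T -> R) (C : R) : measurable D -> 0 <= C ->
  (forall x, D x -> f x <= C) ->
  (\int[mu]_(x in D) (f x)%:E <= C%:E * mu D)%E.
Proof.
move=> mD C0 fC; rewrite -(integral_cst mu mD) integralE.
apply: (@le_trans _ _ (\int[mu]_(x in D) (EFin \o f)^\+ x)%E).
  by rewrite geeDl// oppe_le0 integral_ge0.
apply: ge0_le_integral_nonmeasurable => x Dx //.
by rewrite funeposE /= ge_max !lee_fin C0 fC.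
Qed.

Lemma integral_ge_cst D (f : T -> R) (c : R) : measurable D -> 0 <= c ->
  (forall x, D x -> c <= f x) ->
  (c%:E * mu D <= \int[mu]_(x in D) (f x)%:E)%E.
Proof.
move=> mD c0 cf; rewrite -(integral_cst mu mD).
by apply: ge0_le_integral_nonmeasurable => x Dx; rewrite lee_fin// cf.
Qed.

(** The positive part vanishes and the negative part is at least [c]. This serves to exclude a
    negative volume density. *)
Lemma integral_le_Ncst D (f : T -> R) (c : R) : measurable D -> 0 <= c ->
  (forall x, D x -> c <= - f x) ->
  (\int[mu]_(x in D) (f x)%:E <= - (c%:E * mu D))%E.
Proof.
move=> mD c0 cf; rewrite -(integral_cst mu mD) integralE integral0_eq => [|x Dx].
  rewrite add0e leeN2; apply: ge0_le_integral_nonmeasurable => x Dx //.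
  by rewrite funenegE /= le_max !lee_fin cf.
by rewrite funeposE /= max_r// lee_fin; have := cf _ Dx; lra.
Qed.

End IntegralBounds.

(** * Lebesgue measure of boxes, balls and points *)

Section LebesgueBox.
Context {R : realType}.

Lemma measurable_box m (A : 'I_m -> set R) : (forall k, measurable (A k)) ->
  measurable [set t : m.-tuple R | forall k, A k (tnth t k)].
Proof.
move=> mA.
rewrite (_ : [set _ | _] =
  \bigcap_(k in [set: 'I_m]) ((fun t => tnth t k) @^-1` A k)).
  apply: fin_bigcap_measurable => // k _.
  by rewrite -[X in measurable X]setTI; apply: measurable_tnth.
by apply/seteqP; split => t /= At k => [_|]; exact: At.
Qed.

(** [leb_step] prepends the new coordinate, so the box is, up to [tcons], the product of a box in
    the remaining coordinates and [A ord0]. *)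
Lemma leb_box m (A : 'I_m -> set R) (r : 'I_m -> R) :
  (forall k, measurable (A k)) ->
  (forall k, lebesgue_measure (A k) = (r k)%:E) ->
  leb m [set t : m.-tuple R | forall k, A k (tnth t k)] = (\prod_k r k)%:E.
Proof.
elim: m A r => [|m IH] A r mA Ar.
  by rewrite big_ord0 /= diracE mem_set//= => -[].
rewrite big_ord_recl mulrC EFinM /= /leb_step /pushforward.
rewrite -(IH (A \o lift ord0)) => [|k|k]; [|exact: mA|exact: Ar].
have mB := measurable_box (A := A \o lift ord0) (fun k => mA (lift ord0 k)).
rewrite -Ar -product_measure1E//.
congr (_ _); apply/seteqP; split => -[t x] /=.
  move=> Atx; split => [k|]; have := Atx ord0; have := fun k => Atx (lift ord0 k).
    by move=> /(_ k); rewrite (tnth_nth 0) /= -tnth_nth.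
  by rewrite (tnth_nth 0).
move=> [At Ax] k; have [j ->|->] := unliftP ord0 k.
  by rewrite (tnth_nth 0) /= -tnth_nth; exact: At.
by rewrite (tnth_nth 0).
exact: mA.
Qed.

(** Row vectors carry the sup norm, hence the ball is a cube of side 2e. *)
Lemma leb_ball n (c : Cn R n) (e : R) : 0 < e ->
  measurable (row_of @^-1` ball c e) /\
  leb (n + n) (row_of @^-1` ball c e) = ((e *+ 2) ^+ (n + n))%:E.
Proof.
move=> e0.
have -> : row_of @^-1` ball c e =
    [set t | forall k, ball (c 0 k) e (tnth t k)].
  apply/seteqP; split => t /=.
    by move=> [_ ct] k; have := ct 0 k; rewrite mxE.
  by move=> ct; split => // i k; rewrite mxE ord1; exact: ct.
split.
  by apply: (measurable_box (A := fun k => ball (c 0 k) e)) => k; exact: measurable_ball.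
rewrite (leb_box (A := fun k => ball (c 0 k) e) (r := fun=> e *+ 2)) => [|k|k].
- by rewrite prodr_const card_ord.
- exact: measurable_ball.
- by rewrite lebesgue_measure_ball// ltW.
Qed.

Lemma leb_set1 n (c : Cn R n) : (0 < n)%N ->
  measurable (row_of @^-1` [set c]) /\ leb (n + n) (row_of @^-1` [set c]) = 0%E.
Proof.
move=> n0.
have -> : row_of @^-1` [set c] = [set t | forall k, [set c 0 k] (tnth t k)].
  apply/seteqP; split => t /=; first by move=> <- k; rewrite mxE.
  by move=> ct; apply/rowP => k; rewrite mxE.
split.
  by apply: (measurable_box (A := fun k => [set c 0 k])) => k; exact: measurable_set1.
rewrite (leb_box (A := fun k => [set c 0 k]) (r := fun=> 0)) => [|k|k].
- by rewrite prodr_const card_ord expr0n addn_eq0 -leqn0 leqNgt n0.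
- exact: measurable_set1.
- exact: lebesgue_measure_set1.
Qed.

End LebesgueBox.

(** * Volume of open sets, of points and of the whole manifold *)

Section Volume.
Context {R : realType} {n : nat} {M : ptopologicalType}.
Variables (K : closed_kahler_manifold R n M)
  (mu : {measure set (borel M) -> \bar R}).
Hypothesis hmu : is_volume_measure K mu.
Implicit Types (i : chart_index (atlas K)) (p : M).

Lemma open_chart_preimage i (U : set (Cn R n)) :
  open U -> open (dom i `&` chart i @^-1` U).
Proof.
move=> oU; rewrite openE => p [Dp Up]; apply: filterI.
  by apply: open_nbhs_nbhs; split => //; exact: dom_open.
by apply: chart_continuous => //; exact: open_nbhs_nbhs.
Qed.

Lemma image_chart_preimage i (U : set (Cn R n)) : U `<=` chart i @` dom i ->
  chart i @` (dom i `&` chart i @^-1` U) = U.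
Proof.
move=> sub; apply/seteqP; split => [_ [p [_ Up] <-]//|x Ux].
by have [p Dp px] := sub _ Ux; exists p => //; split => //=; rewrite px.
Qed.

Lemma borel_open (U : set M) : open U -> measurable (U : set (borel M)).
Proof. by move=> oU; exact: sub_sigma_algebra. Qed.

Lemma continuous_volume_density i x : (chart i @` dom i) x ->
  {for x, continuous (volume_density (K := K) i)}.
Proof.
move=> Dx; have oD : open (chart i @` dom i) by exact: chart_image_open.
apply: (Ck_continuous (k := 0)) Dx.
rewrite /volume_density /wedge_power.
apply: Ck_mul => //; first exact: Ck_cst.
apply: Ck_mul => //; first exact: Ck_cst.
apply: Ck_sum => // s; apply: Ck_mul => //; first exact: Ck_cst.
by apply: Ck_prod => // k; exact: form_smooth.
Qed.

Lemma volume_density_neq0 i x : (chart i @` dom i) x ->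
  volume_density (K := K) i x != 0.
Proof.
move=> Dx; rewrite mulf_neq0 ?invr_eq0 ?pnatr_eq0 -?lt0n ?fact_gt0//.
apply: wedge_power_neq0.
- by move=> a u v w; exact: form_linear.
- by move=> u v; exact: form_alternating.
- by move=> u v; exact: form_J_invariant.
- by move=> v; exact: form_positive.
Qed.

(** Only the nonvanishing of the density is known here, so its sign is left open; by continuity it
    stays near its value at [p], within half of its absolute value. *)
Lemma volume_density_bounds i p : dom i p -> exists e c C : R,
  [/\ 0 < e, 0 < c, 0 <= C, ball (chart i p) e `<=` chart i @` dom i &
    (forall x, ball (chart i p) e x -> volume_density (K := K) i x <= C) /\
    ((forall x, ball (chart i p) e x -> c <= volume_density (K := K) i x) \/
     (forall x, ball (chart i p) e x -> c <= - volume_density (K := K) i x))].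
Proof.
move=> Dp; set r := volume_density (K := K) i; set x0 := chart i p.
have Dx0 : (chart i @` dom i) x0 by exists p.
have r0 : 0 < `|r x0| / 2 by rewrite divr_gt0 ?normr_gt0// volume_density_neq0.
have : \forall x \near x0, (chart i @` dom i) x /\ `|r x0 - r x| < `|r x0| / 2.
  apply: filterI; first by apply: open_nbhs_nbhs; split => //; exact: chart_image_open.
  by have /cvgrPdist_lt := continuous_volume_density Dx0; apply.
move=> /nbhs_ballP[e /= e0 eP].
exists e, (`|r x0| / 2), (2 * `|r x0|); split => //.
- by move=> x /eP[].
split=> [x /eP[_ +]|].
  by have := ler_norm (r x0); rewrite ltr_norml => ? /andP[? ?]; lra.
have [rx0|rx0] := leP 0 (r x0); [left|right] => x /eP[_ +];
  rewrite ltr_norml ?(ger0_norm rx0) ?(ltr0_norm rx0) => /andP[? ?]; lra.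
Qed.

Lemma volume_nbhs p : exists U : set M,
  [/\ open U, U p, (mu U < +oo)%E & (0 < mu U)%E].
Proof.
have [i Dp] := dom_cover (atlas K) p.
have [e [c [C [e0 c0 C0 sub [rC rc]]]]] := volume_density_bounds Dp.
set B := ball (chart i p) e.
have [mB lB] := leb_ball (chart i p) e0.
pose U := dom i `&` chart i @^-1` B.
have oU : open U by apply: open_chart_preimage; exact: ball_open.
have muU := hmu (borel_open oU) (@subIsetl _ _ _).
rewrite image_chart_preimage// in muU.
have lB0 : 0 < (e *+ 2) ^+ (n + n) by rewrite exprn_gt0// pmulrn_lgt0.
exists U; split => //.
- by split => //; exact: ballxx.
- rewrite muU; apply: le_lt_trans (integral_le_cst _ mB C0 _) _.
    by move=> t; exact: rC.
  by rewrite lB -EFinM ltry.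
have [rc1|rc2] := rc.
  rewrite muU; apply: lt_le_trans (integral_ge_cst (c := c) _ mB (ltW c0) _).
    by rewrite lB -EFinM lte_fin mulr_gt0.
  by move=> t; exact: rc1.
(* A negative density would give [U] a negative measure. *)
suff : (mu U < 0)%E by rewrite ltNge measure_ge0.
rewrite muU; apply: le_lt_trans (integral_le_Ncst (c := c) _ mB (ltW c0) _) _.
  by move=> t; exact: rc2.
by rewrite lB -EFinM lte_fin oppr_lt0 mulr_gt0.
Qed.

Lemma borel_set1 p : measurable ([set p] : set (borel M)).
Proof.
rewrite -[X in measurable X]setCK; apply: measurableC; apply: borel_open.
rewrite openC; apply: compact_closed; first exact: hausdorff_carrier K.
exact: compact_set1.
Qed.

Lemma volume_set1 p : (0 < n)%N -> mu [set p] = 0%E.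
Proof.
move=> n0; have [i Dp] := dom_cover (atlas K) p.
have mp := borel_set1 p.
have [mc lc] := leb_set1 (chart i p) n0.
apply/eqP; rewrite eq_le measure_ge0 andbT (hmu mp (i := i)); last by move=> _ ->.
rewrite image_set1; set r := volume_density (K := K) i (chart i p).
have := integral_le_cst (f := fun t => volume_density (K := K) i (row_of t))
  (leb (n + n)) mc (normr_ge0 r).
by rewrite lc mule0; apply => t /= ->; exact: ler_norm.
Qed.

(** By compactness, finitely many open sets of finite measure cover [M]. *)
Lemma volume_finite : (mu setT < +oo)%E.
Proof.
have [U UP] := choice volume_nbhs.
have := compact_carrier K; rewrite compact_cover => /(_ M setT U)[].
- by move=> p _; have [] := UP p.
- by move=> p _; exists p => //; have [] := UP p.
move=> X _ XT.
have [mX fX] : measurable (\bigcup_(p in [set` X]) (U p : set (borel M))) /\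
    (mu (\bigcup_(p in [set` X]) U p) < +oo)%E.
  rewrite bigcup_fset; elim/big_ind : _ => [|A B [mA fA] [mB fB]|p _].
  - by rewrite measure0.
  - split; first exact: measurableU.
    by rewrite (le_lt_trans (measureU2 _ _ _))// lte_add_pinfty.
  - by have [oU _ fU _] := UP p; split => //; exact: borel_open.
apply: le_lt_trans fX; apply: le_measure; rewrite ?inE//.
Qed.

Lemma volume_gt0 : (0 < mu setT)%E.
Proof.
have [U [oU _ _ U0]] := volume_nbhs point.
by apply: (lt_le_trans U0); apply: le_measure; rewrite ?inE//; exact: borel_open.
Qed.

End Volume.

(** * Smooth functions and bumps on the manifold *)

Section SmoothFunctions.
Context {R : realType} {n : nat} {M : ptopologicalType}.
Variable K : closed_kahler_manifold R n M.
Implicit Types (i j : chart_index (atlas K)) (p : M) (f g : M -> R).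

Let open_image i : open (chart i @` dom i).
Proof. exact: chart_image_open. Qed.

Lemma smooth_continuous f : smooth K f -> continuous f.
Proof.
move=> sf p; have [i Dp] := dom_cover (atlas K) p.
have Dx : (chart i @` dom i) (chart i p) by exists p.
have cf : {for p, continuous (f \o chart_inv i \o chart i)}.
  apply: continuous_comp; first exact: chart_continuous.
  exact: Ck_continuous (sf i 0) Dx.
have nD : \forall q \near p, dom i q.
  by apply: open_nbhs_nbhs; split => //; exact: dom_open.
move: cf; rewrite /prop_for /continuous_at /= chartK//; apply: cvg_trans.
by apply: near_eq_cvg; apply: filterS nD => q Dq /=; rewrite chartK.
Qed.

Lemma smooth_cst (a : R) : smooth K (fun=> a).
Proof. by move=> i k; exact: Ck_cst. Qed.

Lemma smooth_add f g : smooth K f -> smooth K g -> smooth K (fun p => f p + g p).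
Proof.
move=> sf sg i k.
exact: (Ck_add (f := f \o chart_inv i) (@open_image i) (sf i k) (sg i k)).
Qed.

Lemma smooth_mul f g : smooth K f -> smooth K g -> smooth K (fun p => f p * g p).
Proof.
move=> sf sg i k.
exact: (Ck_mul (f := f \o chart_inv i) (@open_image i) (sf i k) (sg i k)).
Qed.

Lemma smooth_expR f (a b : R) : smooth K f -> smooth K (fun p => a * expR (b * f p)).
Proof.
move=> sf i k.
exact: (Ck_expR (f := f \o chart_inv i) _ _ (@open_image i) (sf i k)).
Qed.

Lemma smooth_comp_expR f : smooth K f -> smooth K (fun p => expR (f p)).
Proof. by move=> /(smooth_expR 1 1); under eq_fun do rewrite !mul1r. Qed.

Definition half_exp f p : R := expR (2^-1 * f p).

Lemma smooth_half_exp f : smooth K f -> smooth K (half_exp f).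
Proof. by move=> /(smooth_expR 1 2^-1); under eq_fun do rewrite mul1r. Qed.

Lemma half_exp_sqr f p : half_exp f p ^+ 2 = expR (f p).
Proof. by rewrite /half_exp -expRM_natl; congr expR; field. Qed.

Lemma smooth_exprn f m : smooth K f -> smooth K (fun p => f p ^+ m).
Proof.
move=> sf; elim: m => [|m IH]; first exact: smooth_cst.
by under eq_fun do rewrite exprS; exact: smooth_mul.
Qed.

Lemma continuous_borel_measurable f : continuous f ->
  measurable_fun setT (f : borel M -> R).
Proof.
move=> cf; apply: (measurability _ (RGenOInfty.measurableE R)).
move=> _ [_ [x ->] <-]; rewrite setTI; apply: borel_open.
by apply: open_comp => [y _|]; [exact: cf|exact: interval_open].
Qed.

Lemma continuous_integrable (mu : {measure set (borel M) -> \bar R}) f :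
  (mu setT < +oo)%E -> continuous f ->
  mu.-integrable setT (EFin \o (f : borel M -> R)).
Proof.
move=> fmu cf; apply: measurable_bounded_integrable => //.
  exact: continuous_borel_measurable.
have /compact_bounded[C [Cr CP]] : compact (f @` setT).
  apply: continuous_compact (compact_carrier K).
  exact: continuous_subspaceT.
exists C; split => // x Cx p _.
by apply: (CP _ Cx); exists p.
Qed.

End SmoothFunctions.

(** * Bump functions *)

Section Bump.
Context {R : realType} {n : nat} {M : ptopologicalType}.
Variable K : closed_kahler_manifold R n M.
Implicit Types (i j : chart_index (atlas K)) (p : M).

Lemma open_chart_image j (U : set M) : open U -> open (chart j @` (dom j `&` U)).
Proof.
move=> oU.
have -> : chart j @` (dom j `&` U) = (chart j @` dom j) `&` chart_inv j @^-1` U.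
  apply/seteqP; split => [_ [p [Dp Up] <-]|x [[p Dp <-]] /=].
    by split => /=; [exists p|rewrite chartK].
  by rewrite chartK// => Up; exists p.
have oD : open (chart j @` dom j) by exact: chart_image_open.
rewrite openE => x [Dx Ux]; apply: filterI; first exact: open_nbhs_nbhs.
by have cx := Defs.inv_continuous Dx; apply: cx; exact: open_nbhs_nbhs.
Qed.

(** In a chart centred at [c], take exp(-1/(d^2 - |x - c|^2)) divided by its value at [c], and
    extend it by zero. The support lies in a compact set, closed since [M] is Hausdorff, which makes
    the extension smooth. *)
Lemma bump_exists (p0 : M) : exists b : M -> R,
  [/\ smooth K b, b p0 = 1, forall p, 0 <= b p <= 1 & forall p, b p = 1 -> p = p0].
Proof.
have [i Dp0] := dom_cover (atlas K) p0.
set c := chart i p0.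
have Dc : (chart i @` dom i) c by exists p0.
have oDi : open (chart i @` dom i) by exact: chart_image_open.
have [e /= e0 eD] : exists2 e : R, 0 < e & ball c e `<=` chart i @` dom i.
  by have /nbhs_ballP[e] := open_nbhs_nbhs (conj oDi Dc); exists e.
(* Halving the radius puts the closed cube [B] inside the open ball. *)
set d := e / 2; have d0 : 0 < d by rewrite divr_gt0.
pose B := [set x : Cn R n | forall k, `[c 0 k - d, c 0 k + d]%classic (x 0 k)].
have BD : B `<=` chart i @` dom i.
  move=> x Bx; apply: eD; split => // a k; rewrite ord1.
  have := Bx k; rewrite /= in_itv /= => /andP[h1 h2].
  by rewrite /ball /= ltr_norml; apply/andP; split; rewrite /d in h1 h2; lra.
pose S := chart_inv i @` B.
have SD : S `<=` dom i by move=> _ [x /BD[p Dp <-] <-]; rewrite chartK.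
have oS : open (~` S).
  rewrite openC; apply: compact_closed; first exact: hausdorff_carrier K.
  apply: continuous_compact; last first.
    by apply: (rV_compact (A := fun k => `[c 0 k - d, c 0 k + d]%classic)) => k;
      exact: segment_compact.
  apply: continuous_in_subspaceT => x; rewrite inE => /BD; exact: Defs.inv_continuous.
(* The squared Euclidean distance to [c] is smooth, unlike the sup norm. *)
pose q (x : Cn R n) := \sum_k (x 0 k - c 0 k) ^+ 2.
have q_ge0 x : 0 <= q x by apply: sumr_ge0 => k _; exact: sqr_ge0.
have q_ge (x : Cn R n) k : (x 0 k - c 0 k) ^+ 2 <= q x.
  by rewrite /q (bigD1 k)//= lerDl sumr_ge0// => l _; exact: sqr_ge0.
have qc : q c = 0 by rewrite /q big1// => k _; rewrite subrr expr0n.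
pose g x := flat 1 (d ^+ 2 - q x) / flat 1 (d ^+ 2).
have d20 : 0 < d ^+ 2 by rewrite exprn_gt0.
have flat1 (t : R) : 0 < t -> flat 1 t = expR (- t^-1).
  by move=> t0; rewrite /flat t0 hornerC mul1r.
have g_out x : ~ B x -> g x = 0.
  move=> Bx; rewrite /g /flat; case: ifPn => [qd|]; last by rewrite mul0r.
  exfalso; apply: Bx => k; rewrite /= in_itv /=.
  have : (x 0 k - c 0 k) ^+ 2 < d ^+ 2 by have := q_ge x k; lra.
  rewrite -real_normK ?num_real// ltr_pXn2r ?nnegrE ?(ltW d0)//.
  by rewrite ltr_norml => /andP[? ?]; apply/andP; split; lra.
have g_bound x : 0 <= g x <= 1.
  rewrite /g (flat1 (d ^+ 2))// {1 2}/flat.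
  case: ifPn => qd; last by rewrite mul0r lexx ler01.
  rewrite hornerC mul1r divr_ge0 ?expR_ge0//= ler_pdivrMr ?expR_gt0// mul1r.
  by rewrite ler_expR lerN2 lef_pV2 ?posrE//; have := q_ge0 x; lra.
have g_eq1 x : g x = 1 -> x = c.
  rewrite /g (flat1 (d ^+ 2))// /flat; case: ifPn => qd; last first.
    by rewrite mul0r => /eqP; rewrite eq_sym oner_eq0.
  rewrite hornerC mul1r => /(congr1 (fun z => z * expR (- (d ^+ 2)^-1))).
  rewrite mul1r mulfVK ?expR_eq0// => /expR_inj/oppr_inj/invr_inj qx.
  have {}qx : q x = 0 by lra.
  apply/rowP => k; have := q_ge x k; rewrite qx => h; apply/eqP.
  by rewrite -subr_eq0 -sqrf_eq0 eq_le h sqr_ge0.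
pose b p := if p \in dom i then g (chart i p) else 0.
have b_out p : ~ S p -> b p = 0.
  move=> Sp; rewrite /b; case: ifPn => //; rewrite inE => Dp.
  by apply: g_out => Bp; apply: Sp; exists (chart i p) => //; rewrite chartK.
have b_in p : dom i p -> b p = g (chart i p) by move=> Dp; rewrite /b mem_set.
exists b; split => [j k|||p].
- apply: Ck_local => x [p Dp <-].
  (* On [dom i], [b] is [g] composed with a smooth transition map; a point outside [dom i] lies in
     the open complement of [S], where [b] is zero. *)
  have [Dip|Dip] := pselect (dom i p).
    exists (chart j @` (dom j `&` dom i)); split; first by exists p.
    have oU : open (chart j @` (dom j `&` dom i)).
      by apply: open_chart_image; exact: dom_open.
    apply: (eq_Ck (f := fun x => g ((chart i \o chart_inv j) x))) => //.
      by move=> _ [r [Djr Dir] <-] /=; rewrite chartK// b_in.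
    apply: Ck_mul => //; last exact: Ck_cst.
    apply: Ck_flat => //; apply: Ck_add => //; first exact: Ck_cst.
    apply: (eq_Ck (f := fun x =>
      -1 * \sum_l (((chart i \o chart_inv j) x) 0 l - c 0 l) ^+ 2)) => //.
      by move=> y _; rewrite mulN1r.
    apply: Ck_mul => //; first exact: Ck_cst.
    apply: Ck_sum => // l.
    have Cl : Ck k (chart j @` (dom j `&` dom i))
        (fun x => ((chart i \o chart_inv j) x) 0 l - c 0 l).
      apply: Ck_add => //; last exact: Ck_cst.
      by apply: Ck_coord => //; exact: transition_smooth.
    exact: Ck_mul.
  exists (chart j @` (dom j `&` ~` S)); split.
    by exists p => //; split => // /SD.
  apply: (eq_Ck (f := cst 0)); first exact: open_chart_image.
    by move=> _ [r [Djr Sr] <-] /=; rewrite chartK// b_out.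
  exact: Ck_cst.
- by rewrite b_in// /g -/c qc subr0 divff// flat1// gt_eqF// expR_gt0.
- by move=> p; rewrite /b; case: ifPn => // _; rewrite lexx ler01.
- rewrite /b; case: ifPn => [|_ /eqP]; last by rewrite eq_sym oner_eq0.
  rewrite inE => Dp /g_eq1 pc.
  by rewrite -(chartK Dp) pc chartK.
Qed.

End Bump.

(** * The spherical immersion *)

Section Immersion.
Context {R : realType} {n : nat} {M : ptopologicalType}.
Variables (K : closed_kahler_manifold R n M)
  (mu : {measure set (borel M) -> \bar R}).
Hypothesis hmu : is_volume_measure K mu.

Lemma borel_integrable (f : M -> R) : smooth K f ->
  mu.-integrable setT (EFin \o (f : borel M -> R)).
Proof.
move=> /smooth_continuous cf; apply: (continuous_integrable K) => //.
exact: volume_finite hmu.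
Qed.

Lemma Vol_gt0 : 0 < Vol mu.
Proof.
rewrite /Vol /integral_M /Rintegral integral_cst// mul1e fine_gt0//.
by rewrite (volume_gt0 hmu) (volume_finite hmu).
Qed.

Definition sphere_map (u : M -> R) (p : M) : R := 2 * half_exp u p.

Lemma sphere_map_smooth_curve (I : set R) g :
  smooth_curve K I g -> smooth_curve K I (fun t => sphere_map (g t)).
Proof.
move=> sg i z Iz; have [U [f [oU Uz sf fg]]] := sg i z Iz.
exists U, (fun x => 2 * expR (2^-1 * f x)); split => //.
  by move=> k; apply: Ck_expR => //; exact: sf.
by move=> y Iy Uy; rewrite /sphere_map /half_exp -fg.
Qed.

Lemma is_derive_half_exp (y : R) :
  is_derive y 1 (fun x : R => 2 * expR (2^-1 * x)) (expR (2^-1 * y)).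
Proof. by apply: is_derive_eq; rewrite /GRing.scale /=; field. Qed.

(** Chain rule along a filter; the case [within I 0^'] includes the one-sided velocities at an end
    point of [I]. *)
Lemma cvg_difference_quotient (F : set_system R) (FF : Filter F)
    (f : R -> R) (y l v : R) (h : R -> R) :
  is_derive y 1 f l -> (\forall t \near F, t != 0) -> t @[t --> F] --> (0 : R) ->
  t^-1 * (h t - y) @[t --> F] --> v ->
  t^-1 * (f (h t) - f y) @[t --> F] --> l * v.
Proof.
move=> [df dfl] F0 Ft Fv.
(* Carathéodory's slope function, continuous at [y]: it avoids a division by [h t - y], which may
   vanish. *)
pose D x := if x == y then l else (x - y)^-1 * (f x - f y).
have cD : {for y, continuous D}.
  rewrite /prop_for /continuous_at {2}/D eqxx.
  apply/cvgrPdist_lt => e e0.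
  have /cvg_ex[l' fl'] := df.
  have l'l : l' = l by rewrite -dfl; apply/esym/cvg_lim.
  move/cvgrPdist_lt : fl'; rewrite l'l => /(_ e e0).
  rewrite near_withinE => /nbhs_ballP[r /= r0 H]; apply/nbhs_ballP; exists r => //= x.
  rewrite /ball /= -normrN opprB => xr.
  have {H} := H (x - y); rewrite /ball /= sub0r normrN => /(_ xr) H.
  rewrite /D; case: eqP => [_|/eqP xy]; first by rewrite subrr normr0.
  by move: H; rewrite subr_eq0 xy => /(_ isT); rewrite /GRing.scale /= mulr1 subrK.
have hy : h t @[t --> F] --> y.
  have : (fun t => t * (t^-1 * (h t - y)) + y) t @[t --> F] --> y.
    rewrite -[X in _ --> X]add0r -[X in _ --> X + _](mul0r v).
    by apply: cvgD; [exact: cvgM|exact: cvg_cst].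
  apply: cvg_trans; apply: near_eq_cvg; apply: filterS F0 => t t0.
  by rewrite mulVKf// subrK.
have Dh : D (h t) @[t --> F] --> l.
  have -> : l = D y by rewrite /D eqxx.
  exact: (cvg_comp h D hy cD).
apply: cvg_trans (cvgM Dh Fv).
apply: near_eq_cvg; apply: nearW => t /=; rewrite /D.
case: eqP => [->|/eqP hty]; first by rewrite !subrr !mulr0.
by move: (t^-1) => s; field; rewrite subr_eq0.
Qed.

Lemma sphere_map_isometric : isometric_immersion K mu sphere_map.
Proof.
split=> [u [su _]|I g _ [sg _]|u [su _]].
- exact: smooth_expR.
- exact: sphere_map_smooth_curve.
(* The factor 2 in [sphere_map] cancels the 1/2 from the chain rule, and the square of [half_exp u]
   is the weight of the Calabi metric. *)
exists (fun v p => half_exp u p * v p); split; last first.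
  move=> v w _ _; rewrite /euclid /calabi /integral_M; congr Rintegral.
  by apply/funext => p; rewrite -half_exp_sqr; ring.
split=> [v [sv _]|a v w _ _|I g v _ _ _ g0 _ gv p].
- by apply: smooth_mul => //; exact: smooth_half_exp.
- by apply/funext => p; ring.
have := gv p; rewrite g0 => gvp; rewrite /sphere_map.
apply: (@cvg_difference_quotient _ _ (fun x => 2 * expR (2^-1 * x)) _ _ _ _ _ _ _ gvp).
- exact: is_derive_half_exp.
- by apply: filterS (nbhs_dnbhs_neq (0 : R)) => t t0 _.
- move=> A A0; rewrite /= /within /=.
  by apply: filterS (nbhs_dnbhs A0) => t At _.
Qed.

Lemma sphere_map_sphere u : calC K mu u ->
  integral_M mu (fun p => sphere_map u p ^+ 2) = (2 * Num.sqrt (Vol mu)) ^+ 2.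
Proof.
move=> [su uV]; rewrite exprMn sqr_sqrtr ?(ltW Vol_gt0)// -uV /integral_M.
have iu : mu.-integrable setT (EFin \o ((fun p => expR (u p)) : borel M -> R)).
  exact: borel_integrable (smooth_comp_expR su).
rewrite -RintegralZl//; congr Rintegral; apply/funext => p.
by rewrite /sphere_map exprMn half_exp_sqr expr2 -natrM.
Qed.

End Immersion.

(** * Distance to the boundary *)

Section Boundary.
Context {R : realType} {n : nat} {M : ptopologicalType}.
Variables (K : closed_kahler_manifold R n M)
  (mu : {measure set (borel M) -> \bar R}).
Hypothesis hmu : is_volume_measure K mu.
Implicit Types (u : M -> R) (w : M -> \bar R) (p : M).

Lemma exp_half_add u w p : w p != +oo%E ->
  exp_half (fun q => ((EFin \o u) q + w q)%E) p = half_exp u p * exp_half w p.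
Proof.
rewrite /exp_half /half_exp /=; case: (w p) => //= [r _|_].
  by rewrite -expRD; congr expR; ring.
by rewrite gt0_mulNye ?lte_fin ?invr_gt0//= mulr0.
Qed.

Lemma exp_half_ge0 w p : 0 <= exp_half w p.
Proof. by apply: fine_ge0; rewrite expeR_ge0. Qed.

Lemma exp_half_sqr w p : w p != +oo%E -> fine (expeR (w p)) = exp_half w p ^+ 2.
Proof.
rewrite /exp_half; case: (w p) => //= [r _|_].
  by rewrite -expRM_natl; congr expR; field.
by rewrite gt0_mulNye ?lte_fin ?invr_gt0//= expr0n.
Qed.

(** Right inverse of [exp_half] on nonnegative functions; zeros are sent to [-oo] separately because
    the real logarithm is meaningless there. *)
Definition log_sqr (f : M -> R) p : \bar R :=
  if f p == 0 then -oo%E else (2 * ln (f p))%:E.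

Lemma exp_half_log_sqr f p : 0 <= f p -> exp_half (log_sqr f) p = f p.
Proof.
rewrite /exp_half /log_sqr; case: eqP => [-> _|/eqP fp0 fp].
  by rewrite gt0_mulNye ?lte_fin ?invr_gt0.
rewrite /= mulrAC mulfV ?mul1r ?lnK// ?pnatr_eq0// posrE.
by rewrite lt_neqAle eq_sym fp0.
Qed.

Lemma boundary_log_sqr (f : M -> R) p0 : smooth K f -> (forall p, 0 <= f p) ->
  f p0 = 0 -> integral_M mu (fun p => f p ^+ 2) = Vol mu ->
  boundary_calC K mu (log_sqr f).
Proof.
move=> sf f0 fp0 fV.
have wfin p : log_sqr f p != +oo%E by rewrite /log_sqr; case: ifP.
have wf : exp_half (log_sqr f) = f by apply/funext => p; exact: exp_half_log_sqr.
split; rewrite ?wf//; last by exists p0; rewrite /log_sqr fp0 eqxx.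
rewrite -fV /integral_M; congr Rintegral; apply/funext => p.
by rewrite exp_half_sqr// wf.
Qed.

Lemma calabi_distE u w : (forall p, w p != +oo%E) ->
  calabi_dist mu (EFin \o u) w = 2 * Num.sqrt (Vol mu) *
    acos ((Vol mu)^-1 * integral_M mu (fun p => half_exp u p * exp_half w p)).
Proof.
move=> wfin; rewrite /calabi_dist; congr (_ * acos (_ * _)).
rewrite /integral_M; congr Rintegral; apply/funext => p; exact: exp_half_add.
Qed.

(** Cauchy-Schwarz in the form 2xy <= x^2 + y^2, both squares having integral [Vol mu]. It keeps the
    argument of [acos] in its domain. *)
Lemma calabi_angle_bounds u w : calC K mu u -> boundary_calC K mu w ->
  0 <= (Vol mu)^-1 * integral_M mu (fun p => half_exp u p * exp_half w p) <= 1.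
Proof.
move=> [su uV] [wfin sw wV _]; have V0 := Vol_gt0 hmu.
have sh := smooth_half_exp su.
apply/andP; split.
  rewrite mulr_ge0 ?invr_ge0 ?(ltW V0)//; apply: Rintegral_ge0 => p _.
  by rewrite mulr_ge0 ?expR_ge0 ?exp_half_ge0.
rewrite ler_pdivrMl// mulr1.
have ih := borel_integrable hmu (smooth_mul sh sh).
have iw := borel_integrable hmu (smooth_mul sw sw).
have ihw := borel_integrable hmu (smooth_mul sh sw).
have i2 := borel_integrable hmu (smooth_mul (smooth_cst (K := K) 2) (smooth_mul sh sw)).
have isum := borel_integrable hmu (smooth_add (smooth_mul sh sh) (smooth_mul sw sw)).
have : 2 * integral_M mu (fun p => half_exp u p * exp_half w p) <=
    integral_M mu (fun p => half_exp u p * half_exp u p + exp_half w p * exp_half w p).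
  rewrite /integral_M -RintegralZl//; apply: le_Rintegral => //.
  move=> p _; have := sqr_ge0 (half_exp u p - exp_half w p).
  by rewrite sqrrB mulr2n; lra.
rewrite {2}/integral_M RintegralD// -/(integral_M mu _).
rewrite -/(integral_M mu (fun p => exp_half w p * _)).
have -> : integral_M mu (fun p => half_exp u p * half_exp u p) = Vol mu.
  rewrite -uV; congr (integral_M mu _); apply/funext => p.
  by rewrite -expr2 half_exp_sqr.
have -> : integral_M mu (fun p => exp_half w p * exp_half w p) = Vol mu.
  rewrite -wV; congr (integral_M mu _); apply/funext => p.
  by rewrite -expr2 exp_half_sqr.
lra.
Qed.

(** Dominated convergence with bound e^u: the powers of [b] tend to 0 except at [p0], a null set as
    n > 0. *)
Lemma integral_bump_cvg0 u (b : M -> R) p0 : (0 < n)%N -> smooth K u -> smooth K b ->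
  (forall p, 0 <= b p <= 1) -> (forall p, b p = 1 -> p = p0) ->
  integral_M mu (fun p => expR (u p) * b p ^+ k) @[k --> \oo] --> (0 : R).
Proof.
move=> n0 su sb b01 b1.
have se := smooth_comp_expR su.
have ie := borel_integrable hmu se.
have ik k := borel_integrable hmu (smooth_mul se (smooth_exprn k sb)).
have [] := @dominated_convergence _ (borel M) R mu setT measurableT
  (fun k p => (expR (u p) * b p ^+ k)%:E) (cst 0%E) (fun p => (expR (u p))%:E).
- by move=> k; exact: measurable_int (ik k).
- exact: measurable_cst.
- exists [set p0]; split; [exact: borel_set1 K _|exact: volume_set1 hmu _ n0|].
  move=> p /= H; apply: contrapT => pp0; apply: H => _.
  have bp : `|b p| < 1.
    have /andP[b0 bp1] := b01 p; rewrite ger0_norm// lt_neqAle bp1 andbT.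
    by apply/eqP => /b1.
  apply: cvg_EFin; first exact: nearW.
  rewrite /comp /= -[X in _ --> X](mulr0 (expR (u p))).
  by apply: cvgM; [exact: cvg_cst|exact: cvg_expr].
- exact: ie.
- apply: aeW => p k _ /=; rewrite lee_fin.
  have /andP[b0 bp1] := b01 p.
  rewrite ger0_norm ?mulr_ge0 ?expR_ge0 ?exprn_ge0//.
  by rewrite ler_piMr ?expR_ge0 ?exprn_ile1.
move=> _ _; rewrite integral0 => h.
exact: fine_cvg h.
Qed.

(** The boundary point is given by f = c e^(u/2) (1 - b^k). The cosine of its angle to [u] is c I /
    Vol, with I close to Vol for large k and c >= 1. *)
Lemma boundary_angle_small u (a : R) : (0 < n)%N -> calC K mu u -> a < 1 ->
  exists2 w, boundary_calC K mu w &
    a < (Vol mu)^-1 * integral_M mu (fun p => half_exp u p * exp_half w p).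
Proof.
move=> n0 [su uV] a1; have V0 := Vol_gt0 hmu.
have [b [sb bp0 b01 b1]] := bump_exists K point.
have cv := integral_bump_cvg0 n0 su sb b01 b1.
(* The bound by [a] serves the conclusion; the bound by 1/2 forces 2I > Vol, hence J > 0. *)
pose m := Num.max a 2^-1.
have m1 : m < 1 by rewrite /m gt_max a1 invf_lt1 ?ltr1n.
have [k k0 Dk] : exists2 k, (0 < k)%N &
    integral_M mu (fun p => expR (u p) * b p ^+ k) < Vol mu * (1 - m).
  have e0 : 0 < Vol mu * (1 - m) by rewrite mulr_gt0// subr_gt0.
  move/cvgrPdist_lt : cv => /(_ _ e0)[N _ /(_ N.+1 (leqnSn N))] /= H.
  exists N.+1 => //; move: H; rewrite sub0r normrN; apply: le_lt_trans.
  exact: ler_norm.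
have se := smooth_comp_expR su.
have sbk := smooth_exprn k sb.
pose h p := 1 - b p ^+ k.
have sh : smooth K h.
  have := smooth_add (smooth_cst (K := K) 1) (smooth_mul (smooth_cst (K := K) (-1)) sbk).
  by under eq_fun do rewrite mulN1r.
have h01 p : 0 <= h p <= 1.
  have /andP[b0 bp1] := b01 p.
  by rewrite /h subr_ge0 exprn_ile1//= lerBlDr lerDl exprn_ge0.
have ie := borel_integrable hmu se.
have iek := borel_integrable hmu (smooth_mul se sbk).
have ih := borel_integrable hmu (smooth_mul se sh).
have ihh := borel_integrable hmu (smooth_mul se (smooth_mul sh sh)).
set I := integral_M mu (fun p => expR (u p) * h p).
set J := integral_M mu (fun p => expR (u p) * (h p * h p)).
have IE : I = Vol mu - integral_M mu (fun p => expR (u p) * b p ^+ k).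
  rewrite -uV /integral_M -RintegralB//; congr Rintegral; apply/funext => p.
  by rewrite /h; ring.
have Im : Vol mu * m < I by rewrite IE; lra.
have JV : J <= Vol mu.
  rewrite -uV; apply: le_Rintegral => // p _; have /andP[h0 h1] := h01 p.
  by rewrite ler_piMr ?expR_ge0// mulr_ile1.
have i2 := borel_integrable hmu (smooth_mul (smooth_cst (K := K) 2) (smooth_mul se sh)).
have i3 := borel_integrable hmu (smooth_add (smooth_mul se (smooth_mul sh sh)) se).
(* h ^ 2 >= 2 h - 1 *)
have J2I : 2 * I <= J + Vol mu.
  rewrite -uV /I /J /integral_M -RintegralZl// -RintegralD//.
  apply: le_Rintegral => // p _; have := expR_ge0 (u p) => e0.
  have := mulr_ge0 e0 (sqr_ge0 (h p - 1)); rewrite expr2; lra.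
have J0 : 0 < J.
  have m2 : 2^-1 <= m by rewrite /m le_max lexx orbT.
  have : Vol mu * 2^-1 <= Vol mu * m by rewrite ler_pM2l.
  lra.
(* Normalisation making the integral of f^2 equal to Vol; it is at least 1 since J <= Vol. *)
pose c := Num.sqrt (Vol mu / J).
have c2 : c ^+ 2 = Vol mu / J by rewrite sqr_sqrtr// ltW// divr_gt0.
have c1 : 1 <= c.
  by rewrite -[leLHS]sqrtr1; apply: ler_wsqrtr; rewrite ler_pdivlMr ?mul1r.
pose f p := c * (half_exp u p * h p).
have f0 p : 0 <= f p.
  have /andP[h0 _] := h01 p.
  by rewrite mulr_ge0 ?(le_trans ler01 c1)// mulr_ge0// expR_ge0.
have sf : smooth K f.
  exact: smooth_mul (smooth_cst (K := K) c) (smooth_mul (smooth_half_exp su) sh).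
exists (log_sqr f).
  apply: (boundary_log_sqr sf f0 (p0 := point)).
    by rewrite /f /h bp0 expr1n subrr !mulr0.
  have -> : (fun p => f p ^+ 2) = (fun p => c ^+ 2 * (expR (u p) * (h p * h p))).
    by apply/funext => p; rewrite /f -half_exp_sqr; ring.
  by rewrite /integral_M RintegralZl// c2 -/J divfK// gt_eqF.
have -> : (fun p => half_exp u p * exp_half (log_sqr f) p) =
    (fun p => c * (expR (u p) * h p)).
  by apply/funext => p; rewrite exp_half_log_sqr// /f -half_exp_sqr; ring.
rewrite /integral_M RintegralZl// -/I mulrC ltr_pdivlMr//.
(* The chain is a Vol <= m Vol < I <= c I, the last step by c >= 1 and I >= 0. *)
apply: (@le_lt_trans _ _ (Vol mu * m)).
  by rewrite mulrC ler_pM2l// /m le_max lexx.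
apply: (lt_le_trans Im); rewrite ler_peMl//.
apply: Rintegral_ge0 => p _; have /andP[h0 _] := h01 p.
by rewrite mulr_ge0// expR_ge0.
Qed.

Lemma boundary_distance0 u : (0 < n)%N -> calC K mu u ->
  ereal_inf [set (calabi_dist mu (EFin \o u) w)%:E | w in boundary_calC K mu]
    = 0%E.
Proof.
move=> n0 uC; apply/eqP; rewrite eq_le; apply/andP; split; last first.
  apply: le_ereal_inf_tmp => _ [w wB <-]; rewrite lee_fin.
  have /andP[a0 a1] := calabi_angle_bounds uC wB.
  rewrite calabi_distE; last by case: wB.
  rewrite mulr_ge0 ?mulr_ge0 ?sqrtr_ge0// acos_ge0// a1 (le_trans _ a0)//.
apply/lee_addgt0Pr => e e0; rewrite add0e.
set s := 2 * Num.sqrt (Vol mu).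
have s0 : 0 < s by rewrite mulr_gt0// sqrtr_gt0 (Vol_gt0 hmu).
(* An angle of at most e / s gives a distance of at most e; the cap at pi keeps [d] where cosine is
   decreasing. *)
pose d := Num.min (e / s) pi.
have d0 : 0 < d by rewrite lt_min divr_gt0// pi_gt0.
have dpi : d <= pi by rewrite ge_min lexx orbT.
have cd1 : cos d < 1.
  by rewrite -cos0 ltr_cos ?in_itv//= ?lexx ?pi_ge0 ?(ltW d0).
have [w wB aw] := boundary_angle_small n0 uC cd1.
have /andP[a0 a1] := calabi_angle_bounds uC wB.
apply: le_trans (ereal_inf_lbound _) _; first by exists w.
rewrite calabi_distE; last by case: wB.
rewrite lee_fin -/s -ler_pdivlMl//.
set a := (Vol mu)^-1 * _ in aw a0 a1 *.
have a11 : -1 <= a <= 1 by rewrite a1 (le_trans _ a0).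
have [/andP[c0 cpi] cK] := acos_def a11.
apply: (@le_trans _ _ d); last by rewrite mulrC ge_min lexx.
(* An angle larger than [d] would have a cosine below [cos d], contrary to the choice of [w]. *)
rewrite leNgt; apply/negP => dc.
have : cos (acos a) < cos d.
  by rewrite ltr_cos ?in_itv//= ?c0 ?(ltW d0).
by rewrite cK ltNge (ltW aw).
Qed.

End Boundary.

Theorem theorem1p5 (R : realType) (n : nat) (hn : (1 <= n)%N)
    (M : ptopologicalType) (K : closed_kahler_manifold R n M)
    (mu : {measure set (borel M) -> \bar R}) (hmu : is_volume_measure K mu) :
  (exists A : (M -> R) -> M -> R,
     isometric_immersion K mu A /\
     exists r : R, 0 < r /\
       A @` calC K mu `<=`
         [set f | smooth K f /\ integral_M mu (fun p => f p ^+ 2) = r ^+ 2]) /\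
  (forall u0 : M -> R, calC K mu u0 ->
     ereal_inf [set (calabi_dist mu (EFin \o u0) w)%:E | w in boundary_calC K mu]
       = 0%E).
Proof.
split; last by move=> u0; exact: boundary_distance0.
exists (@sphere_map R M); split; first exact: sphere_map_isometric.
exists (2 * Num.sqrt (Vol mu)); split.
  by rewrite mulr_gt0// sqrtr_gt0 (Vol_gt0 hmu).
move=> _ [u uC <-]; split; first by case: uC => su _; exact: smooth_expR.
exact: (sphere_map_sphere hmu).
Qed.
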